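(* Suppose there are constants $b,C_1,C_2>0$ such that the heat kernel $p(t,x,y)$ of $X$ satisfies $$\frac{C_1t}{V(d(x,y))\phi(d(x,y))}\le p(t,x,y)\le\frac{C_2t}{V(d(x,y))\phi(d(x,y))}\quad\text{whenever } d(x,y)\ge\phi^{-1}(t),$$ for every $x\in M\setminus\mathscr N$, $\mu$-almost all $y\in M$ and all $t\in(0,b)$, where $V$ and $\phi$ are strictly increasing functions on $(0,\infty)$ such that, for some constants $c_1,c_2>0$, $d_2\ge d_1>0$ and $c>1$, $$c_1\Big(\frac Rr\Big)^{d_1}\le\frac{V(R)}{V(r)}\le c_2\Big(\frac Rr\Big)^{d_2}\ \ (0<r<R<\infty),\qquad \phi(2r)\le c\,\phi(r)\ \ (r>0).$$ If $\varphi:(0,1)\to(0,\infty)$ is an increasing function satisfying $\int_0^1\frac{1}{\phi(\varphi(t))}\,dt=\infty$, then for all $x\in M\setminus\mathscr N$, $\mathbf P^x$-a.s., $$\limsup_{t\to0}\frac{\sup_{0<s\le t}d(X_s,x)}{\varphi(t)}=\limsup_{t\to0}\frac{d(X_t,x)}{\varphi(t)}=\infty.$$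
   Context: $(M,d)$ is a locally compact, separable, connected metric space in which every ball $B(x,r)=\{y:d(x,y)<r\}$ is relatively compact, and $\mu$ is a Radon measure on $M$ with full support such that $C_*^{-1}V(r)\le\mu(B(x,r))\le C_*V(r)$ for all $x\in M$, $r>0$, where $C_*\ge1$ and $V:(0,\infty)\to(0,\infty)$ is strictly increasing with $V(0)=0$, $V(\infty)=\infty$. Also $\phi:(0,\infty)\to(0,\infty)$, and $\phi^{-1}$ is its inverse function. $(\mathscr E,\mathscr F)$ is a symmetric regular Dirichlet form on $L^2(M,\mu)$ of pure-jump type: there is a symmetric Radon measure $n(\cdot,\cdot)$ on $M\times M\setminus\mathrm{diag}$ with $\mathscr E(u,v)=\int_{M\times M\setminus \mathrm{diag}}(u(x)-u(y))(v(x)-v(y))\,n(dx,dy)$ for $u,v\in\mathscr F\cap C_c(M)$. $X=(X_t,t\ge0;\mathbf P^x;\mathscr F_t)$ is the associated Hunt process, uniquely determined for starting points outside a properly exceptional set $\mathscr N\subset M$, with semigroup $(P_t)$. A heat kernel is a non-negative symmetric measurable function $p$ on $(0,\infty)\times M\times M$ with $P_tf(x)=\int p(t,x,z)f(z)\,\mu(dz)$ and $p(t+s,x,y)=\int p(t,x,z)p(s,z,y)\,\mu(dz)$ for all $s,t>0$, $x\in M\setminus\mathscr N$ and $\mu$-a.a. $y$. *)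

(* Defs.v *)
From HB Require Import structures.
From mathcomp Require Import all_boot all_order all_algebra.
From mathcomp Require Import all_classical all_reals all_analysis.
From mathcomp Require Import measurable_realfun.

Set Implicit Arguments.
Unset Strict Implicit.
Unset Printing Implicit Defensive.

Import Order.TTheory GRing.Theory Num.Theory.
Import numFieldNormedType.Exports.

Local Open Scope classical_set_scope.
Local Open Scope ring_scope.

(* Measurable types are pointed, so a metric space carrying measures has to
   be nonempty. *)
#[short(type="pmetricType")]
HB.structure Definition PointedMetric (K : numDomainType) :=
  {M of Metric K M & Pointed M}.

(* The library lacks this join: needed to see M * M as a ptopologicalType. *)
HB.instance Definition _ (T U : ptopologicalType) := Pointed.on (T * U)%type.

Notation borel T := (g_sigma_algebraType (@open T)).

Definition separable (T : topologicalType) :=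
  exists2 D : set T, countable D & dense D.

(* Radon measure on the open subspace D of T: only the values on Borel subsets
   of D matter. *)
Definition radon_on (R : realType) (T : ptopologicalType) (D : set T)
    (m : {measure set (borel T) -> \bar R}) :=
  (forall K : set T, compact K -> K `<=` D -> (m K < +oo)%E) /\
  (forall A : set (borel T), measurable A -> A `<=` D ->
     m A = ereal_sup [set m K | K in [set K : set T | compact K /\ K `<=` A]]).

Definition full_support (R : realType) (T : ptopologicalType)
    (m : {measure set (borel T) -> \bar R}) :=
  forall U : set T, open U -> U !=set0 -> (0 < m U)%E.

(* Inverse of a strictly increasing function on (0, +oo). On the range of phi
   it is the inverse function (see ginvK); it is extended across the possible
   jumps of phi by monotonicity, and equals +oo above the supremum of phi. *)
Definition ginv (R : realType) (phi : R -> R) (t : R) : \bar R :=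
  ereal_inf [set r%:E | r in [set r : R | 0 < r /\ t <= phi r]].

Lemma ginvK (R : realType) (phi : R -> R) (r : R) :
  (forall s u, 0 < s -> s < u -> phi s < phi u) -> 0 < r ->
  ginv phi (phi r) = r%:E.
Proof.
move=> phiI r0; apply/eqP; rewrite eq_le; apply/andP; split.
  by apply: ereal_inf_lbound; exists r.
apply: le_ereal_inf_tmp => _ [s [s0 le_phi] <-]; rewrite lee_fin leNgt.
by apply/negP => sr; have := phiI _ _ s0 sr; rewrite ltNge le_phi.
Qed.

Section DirichletForm.
Context {R : realType} {M : pmetricType R}.
Variable mu : {measure set (borel M) -> \bar R}.

Definition L2 : set (M -> R) := [set f : borel M -> R | f \in Lfun mu 2%:E].

Definition L2norm (f : M -> R) : \bar R :=
  Lnorm mu 2%:E (fun x : borel M => (f x)%:E).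

Definition L2dot (f g : M -> R) : R := \int[mu]_x (f x * g x).

Definition Cc : set (M -> R) :=
  [set f | continuous f /\ compact (closure [set x | f x != 0])].

Definition form1 (E : (M -> R) -> (M -> R) -> R) (u v : M -> R) : R :=
  E u v + L2dot u v.

(* Elements of L^2 are represented by functions, hence the compatibility of
   the domain F and of the form E with mu-a.e. equality. *)
Record dirichlet_form (F : set (M -> R)) (E : (M -> R) -> (M -> R) -> R) :
    Prop := {
  df_L2 : F `<=` L2 ;
  df_ae : forall u v : borel M -> R, F u -> L2 v -> u = v %[ae mu] ->
    F v /\ forall w, F w -> E v w = E u w ;
  df_0 : F (fun _ => 0) ;
  df_lin : forall (a : R) u v, F u -> F v -> F (fun x => a * u x + v x) ;
  df_dense : forall f, L2 f -> forall e : R, 0 < e ->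
    exists2 u, F u & (L2norm (fun x => (f x - u x)%R) < e%:E)%E ;
  df_bilin : forall (a : R) u v w, F u -> F v -> F w ->
    E (fun x => a * u x + v x) w = a * E u w + E v w ;
  df_sym : forall u v, F u -> F v -> E u v = E v u ;
  df_ge0 : forall u, F u -> 0 <= E u u ;
  df_closed : forall u : nat -> M -> R, (forall n, F (u n)) ->
    (forall e : R, 0 < e -> exists n0, forall m n, (n0 <= m)%N -> (n0 <= n)%N ->
       form1 E (fun x => u m x - u n x) (fun x => u m x - u n x) < e) ->
    exists2 v, F v & form1 E (fun x => u n x - v x) (fun x => u n x - v x)
      @[n --> \oo] --> (0 : R) ;
  df_markov : forall u, F u ->
    let v := fun x => Num.min (Num.max (u x) 0) 1 in F v /\ E v v <= E u u
}.

Definition regular_form (F : set (M -> R)) (E : (M -> R) -> (M -> R) -> R) :=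
  (forall u, F u -> forall e : R, 0 < e -> exists2 v, F v /\ Cc v &
     form1 E (fun x => u x - v x) (fun x => u x - v x) < e) /\
  (forall f, Cc f -> forall e : R, 0 < e -> exists2 v, F v /\ Cc v &
     forall x, `|f x - v x| <= e).

Definition offdiag : set (M * M) := [set z | z.1 <> z.2].

Definition jump_measure (n : {measure set (borel (M * M)%type) -> \bar R}) :=
  radon_on offdiag n /\
  (forall A : set (borel (M * M)%type), measurable A -> A `<=` offdiag ->
     n [set z | A (z.2, z.1)] = n A).

Definition pure_jump (F : set (M -> R)) (E : (M -> R) -> (M -> R) -> R)
    (n : {measure set (borel (M * M)%type) -> \bar R}) :=
  forall u v, F u -> Cc u -> F v -> Cc v ->
    (E u v)%:E =
    (\int[n]_(z in offdiag) ((u z.1 - u z.2) * (v z.1 - v z.2))%:E)%E.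

End DirichletForm.

Section HuntProcess.
Context {R : realType} {d : measure_display} {Om : measurableType d}
  {M : pmetricType R}.

(* The state space is M together with the cemetery None, which is the point at
   infinity, or an isolated point if M is compact. *)
Local Notation Mc := (one_point_compactification M).

Variables (P : Mc -> probability Om R) (X : R -> Om -> Mc).
Variable G : R -> set (set Om).

(* Only times t >= 0 are meaningful. *)
Record filtration : Prop := {
  fi_algebra : forall t : R, 0 <= t -> sigma_algebra setT (G t) ;
  fi_measurable : forall t : R, 0 <= t -> G t `<=` measurable ;
  fi_mono : forall s t : R, 0 <= s -> s <= t -> G s `<=` G t ;
  fi_right : forall t : R, 0 <= t -> \bigcap_(s in [set s | t < s]) G s `<=` G t
}.

Definition stopping_time (tau : Om -> \bar R) :=
  (forall w, (0 <= tau w)%E) /\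
  (forall t : R, 0 <= t -> G t [set w | (tau w <= t%:E)%E]).

Definition prior_events (tau : Om -> \bar R) : set (set Om) :=
  [set A | measurable A /\
    forall t : R, 0 <= t -> G t (A `&` [set w | (tau w <= t%:E)%E])].

(* X at a random time, with X_infinity the cemetery. *)
Definition at_time (tau : Om -> \bar R) (w : Om) : Mc :=
  if tau w is t%:E then X t w else None.

(* The simple Markov property is the strong one at a constant time. *)
Record hunt_process : Prop := {
  hu_filtration : filtration ;
  hu_adapted : forall t : R, 0 <= t -> forall B : set (borel Mc), measurable B ->
    G t (X t @^-1` B) ;
  hu_kernel : forall t : R, 0 <= t -> forall B : set (borel Mc), measurable B ->
    measurable_fun [set: borel Mc]
      (fun x : borel Mc => P x (X t @^-1` B)) ;
  hu_normal : forall x, P x [set w | X 0 w = x] = 1%E ;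
  hu_cemetery : forall (s t : R) w, 0 <= s -> s <= t -> X s w = None -> X t w = None ;
  hu_shift : exists theta : R -> Om -> Om,
    forall (s t : R) w, 0 <= s -> 0 <= t -> X s (theta t w) = X (s + t) w ;
  hu_right : forall (t : R) w, 0 <= t -> X s w @[s --> t^'+] --> X t w ;
  hu_left : forall (t : R) w, 0 < t -> exists l : Mc, X s w @[s --> t^'-] --> l ;
  hu_strong_markov : forall x tau A (s : R) (B : set (borel Mc)),
    stopping_time tau -> prior_events tau A -> 0 <= s -> measurable B ->
    P x (A `&` [set w | B (at_time (fun w => tau w + s%:E)%E w)]) =
    (\int[P x]_(w in A) P (at_time tau w) (X s @^-1` B))%E ;
  hu_quasi_left : forall x (taun : nat -> Om -> \bar R) tau,
    (forall n, stopping_time (taun n)) ->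
    (forall m n w, (m <= n)%N -> (taun m w <= taun n w)%E) ->
    (forall w, taun n w @[n --> \oo] --> tau w) ->
    {ae P x, forall w, (tau w < +oo)%E ->
      at_time (taun n) w @[n --> \oo] --> at_time tau w}
}.

(* P_t f (x) = E^x f(X_t), where functions on M vanish at the cemetery. *)
Definition semigroup (t : R) (f : M -> R) (x : M) : \bar R :=
  (\int[P (Some x)]_w (if X t w is Some z then f z else 0%R)%:E)%E.

Definition semigroupR (t : R) (f : M -> R) (x : M) : R := fine (semigroup t f x).

(* X is associated with the form (E, F) on L^2(M, mu): (P_t) induces the
   strongly continuous contraction semigroup on L^2 whose generator A is the
   operator of the form, i.e. u in D(A) and A u = f if and only if u in F and
   E(u, v) = - (f, v) for all v in F. *)
Record associated (mu : {measure set (borel M) -> \bar R})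
    (F : set (M -> R)) (E : (M -> R) -> (M -> R) -> R) : Prop := {
  as_contraction : forall (t : R) f, 0 < t -> L2 mu f ->
    L2 mu (semigroupR t f) /\ (L2norm mu (semigroupR t f) <= L2norm mu f)%E ;
  as_continuous : forall f, L2 mu f ->
    L2norm mu (fun x => (semigroupR t f x - f x)%R) @[t --> 0^'+] --> 0%E ;
  as_generator : forall u f, L2 mu u -> L2 mu f ->
    (L2norm mu (fun x => ((semigroupR t u x - u x) / t - f x)%R)
       @[t --> 0^'+] --> 0%E
     <-> F u /\ forall v, F v -> E u v = - L2dot mu f v)
}.

Definition nearly_borel (N : set M) :=
  forall nu : probability (borel Mc) R,
  exists B1 B2 : set (borel M),
    [/\ measurable B1, measurable B2, B1 `<=` N, N `<=` B2 &
      exists L : set Om, [/\ measurable L, {ae nu, forall x, P x L = 0%E} &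
        forall (t : R) w, 0 <= t -> (Some @` (B2 `\` B1)) (X t w) -> L w]].

Definition properly_exceptional (mu : {measure set (borel M) -> \bar R})
    (N : set M) :=
  [/\ nearly_borel N, mu.-negligible N &
    forall x, ~ N x -> {ae P (Some x), forall w,
      (forall t : R, 0 <= t -> ~ (Some @` N) (X t w)) /\
      (forall (t : R) (l : Mc), 0 < t -> X s w @[s --> t^'-] --> l ->
         ~ (Some @` N) l)}].

Record heat_kernel (mu : {measure set (borel M) -> \bar R}) (N : set M)
    (p : R -> M -> M -> R) : Prop := {
  hk_ge0 : forall (t : R) x y, 0 < t -> 0 <= p t x y ;
  hk_sym : forall (t : R) x y, 0 < t -> p t x y = p t y x ;
  hk_measurable : measurable_fun [set z : R * borel M * borel M | 0 < z.1.1]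
    (fun z : R * borel M * borel M => p z.1.1 z.1.2 z.2) ;
  hk_density : forall (t : R) (f : borel M -> R) x, 0 < t -> ~ N x ->
    measurable_fun [set: borel M] f -> (exists c : R, forall z, `|f z| <= c) ->
    semigroup t f x = (\int[mu]_z (p t x z * f z)%:E)%E ;
  hk_semigroup : forall (s t : R) x, 0 < s -> 0 < t -> ~ N x ->
    {ae mu, forall y,
      (p (t + s) x y)%:E = (\int[mu]_z (p t x z * p s z y)%:E)%E}
}.

(* Distance to x; the value at the cemetery is a convention. *)
Definition dist_from (x : M) (y : Mc) : R :=
  if y is Some z then mdist z x else 0.

End HuntProcess.

(* Main.v *)
(** Put t_k = 2^-k and fix a constant K. Integrating the lower heat kernel
    bound over an annulus of radius comparable with max(K varphi(t_k),
    phi^-1(t_k)) shows that, from any y in the ball B(x, K varphi(t_k)), the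
    process is outside this ball after time t_k - t_(k+1) with probability at
    least q_k = const * min(t_k / phi(varphi(t_k)), 1). Conditioning at the
    times t_(k+1), which run backwards to 0, the Markov property bounds the
    probability that X_(t_k) stays in B(x, K varphi(t_k)) for all m <= k <= n
    by the product of the 1 - q_k, so no conditional Borel-Cantelli lemma is
    needed. The integral condition makes the sum of the q_k diverge, hence
    d(X_(t_k), x) >= K varphi(t_k) infinitely often, or X_(t_k) is in the
    cemetery; the latter is excluded for small times by right continuity at
    time 0. *)

Require Import Defs.
From HB Require Import structures.
From mathcomp Require Import all_boot all_order all_algebra.
From mathcomp Require Import all_classical all_reals all_analysis.
From mathcomp Require Import measurable_realfun.
From mathcomp Require Import ring.

Set Implicit Arguments.
Unset Strict Implicit.
Unset Printing Implicit Defensive.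

Import Order.TTheory GRing.Theory Num.Theory.
Import numFieldNormedType.Exports.

Local Open Scope classical_set_scope.
Local Open Scope ring_scope.

(** * Doubling functions *)

Section Doubling.
Variables (R : realType) (phi : R -> R) (c : R).
Hypothesis c_gt0 : 0 < c.
Hypothesis phi_doubling : forall r, 0 < r -> phi (2 * r) <= c * phi r.

Lemma exists_expr2_ge (a : R) : exists j, a <= 2 ^+ j.
Proof.
have [j aj] : exists j : nat, a <= j%:R.
  by exists (Num.truncn a).+1; rewrite ltW// Num.Theory.truncnS_gt.
by exists j; rewrite (le_trans aj)// -natrX ler_nat ltnW// ltn_expl.
Qed.

Lemma doubling_expr r j : 0 < r -> phi (2 ^+ j * r) <= c ^+ j * phi r.
Proof.
move=> r0; elim: j => [|j IH]; first by rewrite !expr0 !mul1r.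
rewrite exprS -mulrA (le_trans (phi_doubling _)) ?mulr_gt0 ?exprn_gt0//.
by rewrite exprS -mulrA ler_pM2l.
Qed.

Hypothesis phi_incr : forall r s, 0 < r -> r < s -> phi r < phi s.

Lemma increasing_on_pos_le r s : 0 < r -> r <= s -> phi r <= phi s.
Proof. by move=> r0; rewrite le_eqVlt => /predU1P[->//|/phi_incr/ltW]; exact. Qed.

(* As phi may jump, phi rho = s need not be solvable; doubling loses a factor c. *)
Lemma doubling_intermediate (s r0 R0 : R) : 0 < r0 -> 0 < R0 -> s <= phi R0 ->
  exists rho, [/\ r0 <= rho, s <= phi rho & phi rho <= Num.max (phi r0) (c * s)].
Proof.
move=> r00 R00 sR.
have ex : exists j, s <= phi (2 ^+ j * r0).
  have [j aj] := exists_expr2_ge (R0 / r0); exists j.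
  by rewrite (le_trans sR)// increasing_on_pos_le// -ler_pdivrMr.
(* Take the least [j]. If it is 0, [r0] itself serves; otherwise [phi] is still below [s] at the
   previous radius, so the last doubling gives at most [c * s]. *)
case: (ex_minnP ex) => -[|j] sj jmin.
  by exists r0; rewrite expr0 mul1r in sj; rewrite lexx le_max lexx.
exists (2 ^+ j.+1 * r0); split => //.
  by rewrite ler_peMl ?(ltW r00)// exprn_ege1// ler1n.
rewrite le_max; apply/orP; right.
rewrite exprS -mulrA (le_trans (phi_doubling _)) ?mulr_gt0 ?exprn_gt0//.
rewrite ler_pM2l// leNgt; apply/negP => /ltW/jmin.
by rewrite ltnn.
Qed.

End Doubling.

(** * Open balls and their Borel images in the compactification *)

Section Balls.
Variables (R : realType) (M : pmetricType R).

Lemma mball_open (x : M) (r : R) : open (ball x r).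
Proof.
rewrite openE => y; rewrite ballEmdist /= => xy.
have r0 : 0 < r - mdist x y by rewrite subr_gt0.
apply/nbhs_ballP; exists (r - mdist x y) => //= z.
rewrite !ballEmdist /= => yz.
by rewrite (le_lt_trans (metric_triangle x y z))// -ltrBrDl.
Qed.

Lemma measurable_mball (x : M) (r : R) :
  measurable (ball x r : set (borel M)).
Proof. by apply: sub_sigma_algebra; exact: mball_open. Qed.

Lemma measurable_some (U W : set M) : open U -> open W ->
  measurable (Some @` (U `\` W) : set (borel (one_point_compactification M))).
Proof.
move=> oU oW.
rewrite (_ : [set Some x | x in U `\` W] =
    (Some @` U : set (borel (one_point_compactification M))) `\` (Some @` W)).
  by apply: measurableD; apply: sub_sigma_algebra;
    exact: one_point_compactification_open_some.
apply/seteqP; split => [_ [z [Uz Wz] <-]|_ [[z Uz <-]] nWz].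
  by split; [exists z|move=> -[z' Wz' [zz']]; apply: Wz; rewrite -zz'].
by exists z => //; split => // Wz; apply: nWz; exists z.
Qed.

Lemma measurable_some_ball (x : M) (r : R) :
  measurable (Some @` ball x r : set (borel (one_point_compactification M))).
Proof.
by rewrite -(setD0 (ball x r)); apply: measurable_some;
  [exact: mball_open|exact: open0].
Qed.

End Balls.

(** * Volume of annuli *)

Section Annulus.
Variables (R : realType) (M : pmetricType R).
Variables (mu : {measure set (borel M) -> \bar R}) (V : R -> R).
Variables (Cs c1 d1 : R).
Hypothesis V_pos : forall r, 0 < r -> 0 < V r.
Hypothesis Cs_ge1 : 1 <= Cs.
Hypothesis mu_ball : forall (x : M) (r : R), 0 < r ->
  ((Cs^-1 * V r)%:E <= mu (ball x r) <= (Cs * V r)%:E)%E.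
Hypotheses (c1_gt0 : 0 < c1) (d1_gt0 : 0 < d1).
Hypothesis V_scaling : forall r s, 0 < r -> r < s ->
  c1 * (s / r) `^ d1 <= V s / V r.

(** Since [d1 > 0], a large ratio of radii forces V(2^j rho) >= Cs (Cs + 1) V(rho). The outer ball
    then has measure at least (Cs + 1) V(rho), the inner one at most Cs V(rho). *)
Lemma annulus_measure_ge : exists j, forall (y : M) rho, 0 < rho ->
  ((V rho)%:E <= mu (ball y (2 ^+ j * rho) `\` ball y rho))%E.
Proof.
have Cs0 : 0 < Cs by rewrite (lt_le_trans _ Cs_ge1).
pose L := (Cs * (Cs + 1)) / c1.
have L0 : 0 <= L by rewrite /L divr_ge0 ?mulr_ge0 ?addr_ge0// ltW.
(* The second bound gives (2^j)^d1 >= L; the first makes the two radii distinct, as the scaling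
   hypothesis demands. *)
have [j jL] := exists_expr2_ge (Num.max 2 (L `^ d1^-1)).
move: jL; rewrite ge_max => /andP[j2 jL].
exists j => y rho rho0.
have rj : rho < 2 ^+ j * rho.
  by rewrite ltr_pMl// (lt_le_trans _ j2)// ltr1n.
have Lj : L <= (2 ^+ j) `^ d1.
  have := @ge0_ler_powR _ d1 (ltW d1_gt0) (L `^ d1^-1) (2 ^+ j).
  by rewrite -powRrM mulVf ?gt_eqF// powRr1//; apply;
    rewrite ?nnegrE ?powR_ge0.
have VV : Cs * (Cs + 1) * V rho <= V (2 ^+ j * rho).
  have := V_scaling rho0 rj; rewrite mulfK ?gt_eqF// ler_pdivlMr ?V_pos//.
  apply: le_trans; rewrite ler_pM2r ?V_pos//.
  by move: Lj; rewrite /L ler_pdivrMr// [leRHS]mulrC.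
have bj : 0 < 2 ^+ j * rho by rewrite (lt_trans rho0).
have /andP[lo _] := mu_ball y bj.
have /andP[_ hi] := mu_ball y rho0.
have sub : (ball y rho `<=` ball y (2 ^+ j * rho)).
  by move=> z; rewrite !ballEmdist /= => /lt_trans; exact.
have mub : (mu (ball y rho) < +oo)%E by rewrite (le_lt_trans hi)// ltry.
rewrite measureD//; last 3 first.
- exact: measurable_mball.
- exact: measurable_mball.
- by have /andP[_ /le_lt_trans] := mu_ball y bj; apply; rewrite ltry.
rewrite setIidr//.
rewrite leeBrDr; last by rewrite ge0_fin_numE.
apply: le_trans lo; apply: (le_trans (leeD (lexx _) hi)).
rewrite -EFinD lee_fin [leRHS]mulrC ler_pdivlMr// (le_trans _ VV)//.
by rewrite le_eqVlt; apply/orP; left; apply/eqP; ring.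
Qed.

End Annulus.

(** * Exit probabilities from the lower heat kernel bound *)

Section Kernel.
Variables (R : realType) (M : pmetricType R).
Variables (mu : {measure set (borel M) -> \bar R}) (V phi : R -> R).
Hypothesis V_pos : forall r, 0 < r -> 0 < V r.
Hypothesis V_incr : forall r s, 0 < r -> r < s -> V r < V s.
Hypothesis phi_pos : forall r, 0 < r -> 0 < phi r.
Hypothesis phi_incr : forall r s, 0 < r -> r < s -> phi r < phi s.
Variables (c c2 d2 : R).
Hypothesis c_gt1 : 1 < c.
Hypothesis phi_doubling : forall r, 0 < r -> phi (2 * r) <= c * phi r.
Hypothesis c2_gt0 : 0 < c2.
Hypothesis V_scaling : forall r s, 0 < r -> r < s ->
  V s / V r <= c2 * (s / r) `^ d2.

Variables (d : measure_display) (Om : measurableType d).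
Variables (P : one_point_compactification M -> probability Om R).
Variables (X : R -> Om -> one_point_compactification M).
Variable G : R -> set (set Om).
Hypothesis X_hunt : hunt_process P X G.
Variables (N : set M) (p : R -> M -> M -> R).
Hypothesis p_hk : heat_kernel P X mu N p.
Variables (b C1 : R).
Hypothesis C1_gt0 : 0 < C1.
Hypothesis p_lower : forall x, ~ N x -> forall t, 0 < t -> t < b ->
  {ae mu, forall y : M, (ginv phi t <= (mdist x y)%:E)%E ->
    C1 * t / (V (mdist x y) * phi (mdist x y)) <= p t x y}.

Lemma measurable_preimage_hunt (t : R)
    (B : set (borel (one_point_compactification M))) :
  0 <= t -> measurable B -> measurable (X t @^-1` B).
Proof.
move=> t0 mB; apply: (fi_measurable (hu_filtration X_hunt) t0).
exact: (hu_adapted X_hunt).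
Qed.

(** This is the density formula for the bounded function [\1_A]; paths at the cemetery contribute 0
    to both sides. *)
Lemma hunt_density (t : R) (y : M) (A : set (borel M)) :
  0 < t -> ~ N y -> measurable A ->
  measurable (Some @` A : set (borel (one_point_compactification M))) ->
  P (Some y) (X t @^-1` (Some @` A)) = (\int[mu]_(z in A) (p t y z)%:E)%E.
Proof.
move=> t0 Ny mA mSA.
have mI : measurable_fun [set: borel M] (\1_A : borel M -> R) by [].
have bI : exists a : R, forall z : M, `|(\1_A z : R)| <= a.
  by exists 1 => z; rewrite indicE; case: (_ \in _); rewrite ?normr1 ?normr0.
have := hk_density p_hk t0 Ny mI bI; rewrite /semigroup => H.
rewrite [RHS]integral_mkcond.
transitivity (\int[P (Some y)]_w (\1_(X t @^-1` (Some @` A)) w)%:E)%E.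
  by rewrite integral_indic// ?setIT//; exact: measurable_preimage_hunt (ltW t0) mSA.
transitivity (\int[mu]_z (p t y z * \1_A z)%:E)%E.
  rewrite -H; apply: eq_integral => w _; congr EFin; rewrite indicE.
  case Xw : (X t w) => [z|].
    rewrite indicE; congr (_%:R); congr nat_of_bool.
    apply/idP/idP; rewrite !inE /= Xw; first by move=> -[z' Az' [<-]].
    by move=> Az; exists z.
  by rewrite memNset//= Xw => -[].
apply: eq_integral => z _; rewrite patchE indicE.
by case: (_ \in _); rewrite ?mulr1 ?mulr0.
Qed.

Lemma measurable_kernel (t : R) (y : M) : 0 < t ->
  measurable_fun [set: borel M] (p t y : borel M -> R).
Proof.
move=> t0.
have mD : measurable [set z : R * borel M * borel M | 0 < z.1.1].
  have mR : measurable [set r : R | 0 < r].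
    rewrite (_ : [set r : R | 0 < r] = `]0, +oo[%classic)//.
    by apply/seteqP; split=> z /=; rewrite in_itv /= andbT.
  have m1 : measurable [set z : R * borel M | 0 < z.1].
    by have := @measurable_fst _ _ R (borel M) measurableT _ mR; rewrite setTI.
  have := @measurable_fst _ _ (R * borel M)%type (borel M) measurableT _ m1.
  by rewrite setTI.
have := measurable_comp mD _ (hk_measurable p_hk)
  (@pair1_measurable _ _ _ (borel M) (t, (y : borel M))).
by apply; move=> _ [z _ <-] /=.
Qed.

(** On the annulus the distance to y is between rho and 2^j rho, so V and phi there exceed V(rho)
    and phi(rho) by at most constant factors. The kernel is thus at least const * s / (V(rho)
    phi(rho)), and the volume of the annulus cancels V(rho). *)
Lemma heat_kernel_tail (j : nat) :
  (forall (y : M) rho, 0 < rho ->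
     ((V rho)%:E <= mu (ball y (2 ^+ j * rho) `\` ball y rho))%E) ->
  exists2 k : R, 0 < k & forall y, ~ N y -> forall s rho,
    0 < s -> s < b -> 0 < rho -> s <= phi rho ->
    ((k * (s / phi rho))%:E <= P (Some y)
      (X s @^-1` (Some @` (ball y (2 ^+ j * rho) `\` ball y rho))))%E.
Proof.
move=> annulus.
have c0 : 0 < c by rewrite (lt_trans _ c_gt1).
(* The growth of V times the growth of phi over [j] doublings of the radius. *)
have [D D0 DE] : exists2 D, 0 < D & D = c2 * (2 ^+ j) `^ d2 * c ^+ j.
  by eexists; last reflexivity; rewrite !mulr_gt0 ?powR_gt0 ?exprn_gt0.
exists (C1 / D) => [|y Ny s rho s0 sb rho0 s_phi]; first by rewrite divr_gt0.
set A := _ `\` _.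
have mA : measurable (A : set (borel M)).
  by apply: measurableD; exact: measurable_mball.
have Vr := V_pos rho0; have phir := phi_pos rho0.
rewrite hunt_density//; last first.
  by rewrite /A; apply: measurable_some; exact: mball_open.
pose K := C1 * s / (D * (V rho * phi rho)).
have K0 : 0 <= K by apply: divr_ge0; rewrite ltW// !mulr_gt0.
apply: (@le_trans _ _ (\int[mu]_(z in A) (cst K%:E z))%E).
  rewrite integral_cst//; apply: (@le_trans _ _ (K%:E * (V rho)%:E)%E).
    rewrite -EFinM lee_fin /K le_eqVlt; apply/orP; left; apply/eqP.
    by field; rewrite !gt_eqF.
  by rewrite lee_wpmul2l ?lee_fin//; exact: annulus.
apply: ae_ge0_le_integral => //.
- by move=> z _; rewrite lee_fin (hk_ge0 p_hk).
- by apply/measurable_EFinP; apply: measurable_funTS; exact: measurable_kernel.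
apply: (@filterS (borel M) (almost_everywhere mu) _ _ _ _ (p_lower Ny s0 sb)) => z pz.
rewrite /A /= !ballEmdist /= => -[z1 /negP]; rewrite -leNgt => z2.
have dz0 : 0 < mdist y z by rewrite (lt_le_trans rho0).
rewrite lee_fin (le_trans _ (pz _))//; last first.
  (* The kernel bound applies at z: as s <= phi(rho) <= phi(d(y,z)), the distance belongs to the set
     whose infimum is [ginv phi s]. *)
  apply: ereal_inf_lbound; exists (mdist y z) => //; split => //.
  by rewrite (le_trans s_phi)// (increasing_on_pos_le phi_incr).
have j0 : 0 < 2 ^+ j * rho by rewrite (lt_trans dz0).
have rj : rho < 2 ^+ j * rho by rewrite (le_lt_trans z2).
have Vz : V (mdist y z) <= c2 * (2 ^+ j) `^ d2 * V rho.
  rewrite (le_trans (ltW (V_incr dz0 z1)))//.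
  by have := V_scaling rho0 rj; rewrite mulfK ?gt_eqF// ler_pdivrMr.
have phiz : phi (mdist y z) <= c ^+ j * phi rho.
  rewrite (le_trans (ltW (phi_incr dz0 z1)))//.
  exact: (doubling_expr c0 phi_doubling).
rewrite /K ler_pM2l ?mulr_gt0// lef_pV2 ?posrE ?mulr_gt0 ?V_pos ?phi_pos//.
apply: (@le_trans _ _ ((c2 * (2 ^+ j) `^ d2 * V rho) * (c ^+ j * phi rho))).
  by rewrite ler_pM// ltW ?V_pos ?phi_pos.
by rewrite le_eqVlt; apply/orP; left; apply/eqP; rewrite DE; ring.
Qed.

(** An annulus around y with inner radius rho >= 2r misses B(x, r), so its hitting probability
    bounds the escape probability from below. The radius [R0] only guarantees that phi reaches the
    level s. *)
Lemma ball_hitting_le (j : nat) (R0 : R) :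
  (forall (y : M) rho, 0 < rho ->
     ((V rho)%:E <= mu (ball y (2 ^+ j * rho) `\` ball y rho))%E) ->
  0 < R0 ->
  exists2 k : R, 0 < k & forall x y, ~ N y -> forall s r,
    0 < s -> s < b -> s <= phi R0 -> mdist x y < r ->
    (P (Some y) (X s @^-1` (Some @` ball x r)) <=
      (1 - k * Num.min (s / phi r) 1)%:E)%E.
Proof.
move=> annulus R00; have [k k0 tail] := heat_kernel_tail annulus.
have c0 : 0 < c by rewrite (lt_trans _ c_gt1).
exists (k / c) => [|x y Ny s r s0 sb sR xyr]; first by rewrite divr_gt0.
have r0 : 0 < r by rewrite (le_lt_trans (mdist_ge0 x y)).
have r20 : 0 < 2 * r by rewrite mulr_gt0.
have [rho [rrho srho rhos]] :=
  doubling_intermediate c0 phi_doubling phi_incr r20 R00 sR.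
have rho0 : 0 < rho by rewrite (lt_le_trans r20).
set Ann := Some @` (ball y (2 ^+ j * rho) `\` ball y rho).
have mAnn : measurable (X s @^-1` Ann).
  apply: measurable_preimage_hunt (ltW s0) _.
  by apply: measurable_some; exact: mball_open.
have mB : measurable (X s @^-1` (Some @` ball x r)).
  by apply: measurable_preimage_hunt (ltW s0) _; exact: measurable_some_ball.
apply: (@le_trans _ _ (P (Some y) (~` (X s @^-1` Ann)))).
  apply: le_measure; rewrite ?inE//; first exact: measurableC.
  move=> w /= [z xz <-] [z' [_ nyz'] [zz']]; apply: nyz'; move: xz.
  rewrite zz' !ballEmdist /= => xz.
  rewrite (lt_le_trans _ rrho)// (le_lt_trans (metric_triangle y x z))//.
  by rewrite metric_sym mulr2n mulrDl mul1r ltrD.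
rewrite probability_setC// EFinB leeB// (le_trans _ (tail _ Ny _ _ s0 sb rho0 srho))//.
rewrite lee_fin -mulrA ler_pM2l// mulrC ler_pdivrMr//.
have phirho := phi_pos rho0.
(* If phi(rho) <= phi(2r) <= c phi(r), the term s / phi(r) of the minimum is used; if phi(rho) <= c
   s, the term 1. *)
move: rhos; rewrite le_max => /orP[rhos|rhos].
  apply: (@le_trans _ _ (s / phi r)); first by rewrite ge_min lexx.
  have phir := phi_pos r0.
  rewrite mulrAC ler_pdivlMr// mulrAC ler_pdivrMr// -mulrA ler_pM2l//.
  by rewrite (le_trans rhos)// phi_doubling.
apply: (@le_trans _ _ 1); first by rewrite ge_min lexx orbT.
by rewrite mulrAC ler_pdivlMr// mul1r mulrC.
Qed.

End Kernel.

(** * Markov property along decreasing times *)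

Section Markov.
Variables (R : realType) (M : pmetricType R).
Variables (d : measure_display) (Om : measurableType d).
Variables (P : one_point_compactification M -> probability Om R).
Variables (X : R -> Om -> one_point_compactification M).
Variable G : R -> set (set Om).
Hypothesis X_hunt : hunt_process P X G.
Local Notation Mc := (one_point_compactification M).

Lemma stopping_time_cst (u : R) : 0 <= u -> stopping_time G (fun=> u%:E).
Proof.
move=> u0; split=> [w|t t0]; first by rewrite lee_fin.
have [G0 GC _] := fi_algebra (hu_filtration X_hunt) t0.
have [ut|tu] := leP u t.
  rewrite (_ : [set _ | _] = setT `\` set0); first exact: GC.
  by rewrite setD0; apply/seteqP; split => // w _ /=; rewrite lee_fin.
rewrite (_ : [set _ | _] = set0)//.
by apply/seteqP; split => // w /=; rewrite lee_fin leNgt tu.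
Qed.

Lemma filtration_setI (u : R) (A B : set Om) : 0 <= u -> G u A -> G u B ->
  G u (A `&` B).
Proof.
move=> u0 GA GB; have sG := fi_algebra (hu_filtration X_hunt) u0.
have [_ _ _ GI] := (sigma_algebraP (C := G u) (fun _ _ => @subsetT _ _)).1 sG.
exact: GI.
Qed.

Lemma hunt_markov (x : Mc) (u s : R) (A : set Om) (B : set (borel Mc)) :
  0 <= u -> 0 <= s -> G u A -> measurable B ->
  P x (A `&` X (u + s) @^-1` B) =
  (\int[P x]_(w in A) P (X u w) (X s @^-1` B))%E.
Proof.
move=> u0 s0 GA mB; have fG := hu_filtration X_hunt.
apply: (hu_strong_markov X_hunt x (stopping_time_cst u0) _ s0 mB).
split=> [|t t0]; first exact: (fi_measurable fG u0).
have [ut|tu] := leP u t.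
  rewrite (_ : _ `&` _ = A); first exact: (fi_mono fG u0 ut).
  by apply/seteqP; split=> w /=; [case|rewrite lee_fin].
rewrite (_ : _ `&` _ = set0); first by have [] := fi_algebra fG t0.
by apply/seteqP; split => // w [_ /=]; rewrite lee_fin leNgt tu.
Qed.

Variables (t_ : nat -> R) (U : nat -> set (borel Mc)) (q : nat -> R) (x : Mc).
Hypothesis t_gt0 : forall k, 0 < t_ k.
Hypothesis t_decr : forall k, t_ k.+1 < t_ k.
Hypothesis mU : forall k, measurable (U k).
Hypothesis q_bound : forall k, {ae P x, forall w, U k.+1 (X (t_ k.+1) w) ->
  (P (X (t_ k.+1) w) (X (t_ k - t_ k.+1) @^-1` U k) <= (1 - q k)%:E)%E}.

(* The path is in U k at time t_ k for all m <= k <= m + j. *)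
Fixpoint stay (m j : nat) : set Om :=
  if j is j'.+1 then stay m.+1 j' `&` X (t_ m) @^-1` U m
  else X (t_ m) @^-1` U m.

Lemma stay_sub m j : stay m j `<=` X (t_ m) @^-1` U m.
Proof. by case: j => [//|j] w []. Qed.

(** As [t_] decreases, [t_ m] is the latest time that the event involves. *)
Lemma filtration_stay m j : G (t_ m) (stay m j).
Proof.
elim: j m => [|j IH] m /=; first exact: (hu_adapted X_hunt (ltW (t_gt0 m))).
apply: (filtration_setI (ltW (t_gt0 m))).
  exact: (fi_mono (hu_filtration X_hunt) (ltW (t_gt0 _)) (ltW (t_decr m))).
exact: (hu_adapted X_hunt (ltW (t_gt0 m))).
Qed.

Lemma measurable_stay m j : measurable (stay m j).
Proof.
apply: (fi_measurable (hu_filtration X_hunt) (ltW (t_gt0 m))).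
exact: filtration_stay.
Qed.

Lemma measurable_transition (u s : R) (B : set (borel Mc)) :
  0 <= u -> 0 <= s -> measurable B ->
  measurable_fun setT (fun w => P (X u w) (X s @^-1` B)).
Proof.
move=> u0 s0 mB.
have mX : measurable_fun [set: Om] (X u : Om -> borel Mc).
  move=> _ C mC; rewrite setTI.
  apply: (fi_measurable (hu_filtration X_hunt) u0).
  exact: (hu_adapted X_hunt).
exact: (measurableT_comp (hu_kernel X_hunt s0 mB) mX).
Qed.

(** Induction removes the latest time: given the past up to [t_ m.+1], being in [U m] at time [t_ m]
    has probability at most 1 - q_m <= exp(- q_m). *)
Lemma stay_le m j :
  (P x (stay m j) <= (expR (- \sum_(i < j) q (m + i)%N))%:E)%E.
Proof.
elim: j m => [|j IH] m.
  by rewrite big_ord0 oppr0 expR0; apply: probability_le1; exact: measurable_stay.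
have s0 : 0 <= t_ m - t_ m.+1 by rewrite subr_ge0 ltW.
rewrite /= -[in X (t_ m)](subrKC (t_ m.+1) (t_ m)) hunt_markov//; last 2 first.
- exact: ltW.
- exact: filtration_stay.
apply: (@le_trans _ _
    (\int[P x]_(w in stay m.+1 j) (cst (expR (- q m))%:E w))%E).
  apply: ae_ge0_le_integral => //.
  - exact: measurable_stay.
  - apply: measurable_funTS; apply: measurable_transition => //; exact: ltW.
  - by move=> w _ /=; rewrite lee_fin expR_ge0.
  (* The transition bound is available here because the path is in [U m.+1] at time [t_ m.+1] on
     this event. *)
  apply: filterS (q_bound m) => w qw /stay_sub/qw/le_trans; apply.
  by rewrite lee_fin /= expR_ge1Dx.
rewrite integral_cst; last exact: measurable_stay.
rewrite big_ord_recl addn0 opprD expRD EFinM lee_pmul2l ?lte_fin ?expR_gt0//.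
apply: (le_trans (IH _)); rewrite lee_fin ler_expR lerN2.
by apply: ler_sum => i _; rewrite addSnnS.
Qed.

Lemma ae_leave m : (forall B : R, exists j, B <= \sum_(i < j) q (m + i)%N) ->
  {ae P x, forall w, exists2 k, (m <= k)%N & ~ U k (X (t_ k) w)}.
Proof.
move=> q_infty.
exists (\bigcap_j stay m j); split.
- by apply: bigcap_measurable => // j _; exact: measurable_stay.
- set Z := \bigcap_j _.
  have mZ : measurable Z by apply: bigcap_measurable => // j _; exact: measurable_stay.
  apply/eqP; rewrite eq_le measure_ge0 andbT.
  apply/lee_addgt0Pr => e e0; rewrite add0e.
  (* If the partial sum S is at least 1/e, then exp(-S) <= 1 / (1 + S) <= e. *)
  have [j ej] := q_infty e^-1.
  apply: (@le_trans _ _ (P x (stay m j))).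
    apply: le_measure; rewrite ?inE//; first exact: measurable_stay.
    by apply: bigcap_inf.
  apply: (le_trans (stay_le m j)).
  rewrite lee_fin expRN -[leRHS]invrK lef_pV2 ?posrE ?expR_gt0 ?invr_gt0//.
  rewrite (le_trans ej)// (le_trans _ (expR_ge1Dx _))// lerDr//.
move=> w /= /forall2NP all_in j _.
have {}all_in k : (m <= k)%N -> U k (X (t_ k) w).
  by move=> mk; have [//|/contrapT] := all_in k.
elim: j m {q_infty} all_in => [|j IH] m all_in /=; first exact: all_in.
split; last exact: all_in.
by apply: IH => k /ltnW; exact: all_in.
Qed.

End Markov.

(** * Dyadic times: integral against series, and limits superior *)

Section Dyadic.
Variable R : realType.

(** Preimages of closed upper half-lines are intervals, and these half-lines generate the Borel
    sets. *)
Lemma nonincreasing_on_measurable (D : set R) (f : R -> R) :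
  is_interval D -> (forall s t, D s -> D t -> s <= t -> f t <= f s) ->
  measurable_fun D f.
Proof.
move=> itvD f_ni.
apply: (measurability (@RGenCInfty.G R)) => [|/= _ [_] [r] -> <-].
  exact: RGenCInfty.measurableE.
apply: is_interval_measurable => s t [Ds _] [Dt /=].
rewrite in_itv /= andbT => ft u sut; have Du := itvD _ _ Ds Dt _ sut.
split=> //=; rewrite in_itv /= andbT (le_trans ft)// f_ni//.
by case/andP: sut.
Qed.

Definition dyadic (k : nat) : R := 2^-1 ^+ k.

Lemma dyadic_gt0 k : 0 < dyadic k.
Proof. by rewrite exprn_gt0// invr_gt0. Qed.

Lemma dyadicS k : dyadic k.+1 = dyadic k / 2.
Proof. by rewrite /dyadic exprSr. Qed.

Lemma dyadicB k : dyadic k - dyadic k.+1 = dyadic k.+1.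
Proof. by rewrite dyadicS {1}(splitr (dyadic k)) addrK. Qed.

Lemma dyadic_ltS k : dyadic k.+1 < dyadic k.
Proof. by rewrite -subr_gt0 dyadicB dyadic_gt0. Qed.

Lemma dyadic_le k l : (k <= l)%N -> dyadic l <= dyadic k.
Proof.
by move=> kl; rewrite ler_wiXn2l// ?invr_ge0// invf_le1// ler1n.
Qed.

Lemma dyadic_lt1 k : dyadic k.+1 < 1.
Proof. by rewrite (lt_le_trans (dyadic_ltS k))// (dyadic_le (leq0n k)). Qed.

Lemma exists_dyadic_lt (e : R) : 0 < e -> exists k, dyadic k < e.
Proof.
move=> e0; have [j ej] := exists_expr2_ge (2 * e^-1); exists j.
rewrite /dyadic exprVn -[ltRHS]invrK ltf_pV2 ?posrE ?invr_gt0 ?exprn_gt0//.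
by rewrite (lt_le_trans _ ej)// mulr2n mulrDl mul1r ltrDl invr_gt0.
Qed.

Let block k : set R := `[dyadic k.+1, dyadic k[%classic.

Lemma bigcup_dyadic_block : \bigcup_k block k = `]0, 1[%classic.
Proof.
apply/seteqP; split=> t /=; rewrite in_itv /=.
  move=> [k _]; rewrite /block /= in_itv /= => /andP[tk kt].
  rewrite (lt_le_trans (dyadic_gt0 _) tk) (lt_le_trans kt)//.
  exact: (dyadic_le (leq0n k)).
move=> /andP[t0 t1].
have ex : exists k, dyadic k.+1 <= t.
  have [k kt] := exists_dyadic_lt t0; exists k.
  by rewrite (le_trans (ltW (dyadic_ltS k)))// ltW.
case: (ex_minnP ex) => k kt kmin; exists k => //.
rewrite /block /= in_itv /= kt /=; case: k kmin {kt} => [//|k] kmin.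
by rewrite ltNge; apply/negP => /kmin; rewrite ltnn.
Qed.

Lemma trivIset_dyadic_block : trivIset setT block.
Proof.
apply/trivIsetP => i j _ _; wlog ij : i j / (i < j)%N => [wl|_].
  have [ij|ji|->] := ltngtP i j; rewrite ?eqxx//.
    by move=> ?; apply: wl => //; rewrite ltn_eqF.
  by move=> ?; rewrite setIC; apply: wl => //; rewrite ltn_eqF.
apply/seteqP; split => // t [] /=; rewrite /block /= !in_itv /=.
move=> /andP[it _] /andP[_ tj].
by have := lt_le_trans tj (le_trans (dyadic_le ij) it); rewrite ltxx.
Qed.

(** On each block [f] is at most its value at the left endpoint 2^-(k+1), which is also the length
    of the block; the series therefore dominates the integral. *)
Lemma dyadic_series_infty (f : R -> R) :
  (forall t, 0 < t -> t < 1 -> 0 <= f t) ->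
  (forall s t, 0 < s -> s <= t -> t < 1 -> f t <= f s) ->
  (\int[lebesgue_measure]_(t in `]0%R, 1%R[) (f t)%:E = +oo)%E ->
  (\sum_(k <oo) (f (dyadic k.+1) * dyadic k.+1)%:E = +oo)%E.
Proof.
move=> f0 f_ni fint.
have f0' t : `]0%R, 1%R[%classic t -> (0 <= (f t)%:E)%E.
  by rewrite /= in_itv /= => /andP[? ?]; rewrite lee_fin f0.
have mf : measurable_fun (`]0%R, 1%R[%classic : set R) (fun t => (f t)%:E).
  apply/measurable_EFinP; apply: nonincreasing_on_measurable.
    exact: interval_is_interval.
  move=> s t; rewrite /= !in_itv /= => /andP[s0 _] /andP[_ t1] st.
  exact: f_ni.
have mblock k : measurable (block k) by exact: measurable_itv.
have sub k : block k `<=` `]0%R, 1%R[%classic.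
  by rewrite -bigcup_dyadic_block; exact: bigcup_sup.
have := fint; rewrite -bigcup_dyadic_block ge0_integral_bigcup//; last 3 first.
- by rewrite bigcup_dyadic_block.
- by rewrite bigcup_dyadic_block.
- exact: trivIset_dyadic_block.
move=> sum_infty; apply/eqP; rewrite -leye_eq -sum_infty.
apply: lee_nneseries => [k _ _|k _].
  by apply: integral_ge0 => t kt; exact: f0' (sub k t kt).
apply: (@le_trans _ _ (\int[lebesgue_measure]_(t in block k)
    (cst (f (dyadic k.+1))%:E t))%E).
  apply: ge0_le_integral => //.
  - exact: mblock.
  - by move=> t kt; exact: f0' (sub k t kt).
  - by apply: measurable_funS mf => //; exact: measurable_itv.
  move=> t kt; have := sub k t kt; move: kt.
  rewrite /block /= !in_itv /= lee_fin => /andP[kt _] /andP[_ t1].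
  by apply: f_ni => //; exact: dyadic_gt0.
have mu_block : (lebesgue_measure (block k) = (dyadic k.+1)%:E :> \bar R)%E.
  by rewrite /block lebesgue_measure_itv /= lte_fin dyadic_ltS -EFinD dyadicB.
rewrite EFinM -mu_block le_eqVlt; apply/orP; left; apply/eqP.
by apply: integral_cst; exact: mblock.
Qed.

(** If the truncated sums were bounded, their terms would tend to 0 and eventually be below 1. From
    there on the truncation changes nothing, so the series of [a] itself would be finite. *)
Lemma truncated_series_unbounded (a : nat -> R) :
  (forall k, 0 <= a k) -> (\sum_(k <oo) (a k)%:E = +oo)%E ->
  forall (m : nat) (B : R), exists j, B <= \sum_(i < j) Num.min (a (m + i)%N) 1.
Proof.
move=> a0 a_infty m B; apply: contrapT => /forallNP noj.
pose q i := Num.min (a (m + i)%N) 1.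
have q0 i : 0 <= q i by rewrite le_min a0 ler01.
have qB j : \sum_(i < j) q i <= B.
  by have /negP := noj j; rewrite -ltNge => /ltW.
have /cvg_series_cvg_0 q_0 : cvgn (series q).
  apply: nondecreasing_is_cvgn; first by move=> i j; exact: nondecreasing_series.
  by exists B => _ [j _ <-]; rewrite seriesEord /=; exact: qB.
have [n0 _ qlt1] : \forall i \near \oo, q i < 1.
  by apply: (cvgr_lt (0 : R)) => //; rewrite ltr01.
have aq i : (n0 <= i)%N -> a (m + i)%N = q i.
  by move=> /qlt1 /=; rewrite /q gt_min ltxx orbF => /ltW/min_idPl ->.
pose C := \sum_(k < m + n0) a k + B.
have aC n : \sum_(k < n) a k <= C.
  apply: (@le_trans _ _ (\sum_(k < m + n0 + n) a k)).
    by rewrite addnC big_split_ord /= lerDl sumr_ge0.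
  rewrite big_split_ord /= lerD2l (le_trans _ (qB (n0 + n)%N))//.
  rewrite big_split_ord /= ler_wpDl ?sumr_ge0// ler_sum// => i _.
  by rewrite -addnA aq// leq_addr.
suff : (\sum_(k <oo) (a k)%:E <= C%:E)%E by rewrite a_infty.
apply: lime_le; first by apply: is_cvg_nneseries => k _ _; rewrite lee_fin.
by apply: nearW => n; rewrite sumEFin lee_fin big_mkord.
Qed.

(** Every right neighbourhood of 0 contains all sufficiently late dyadic times, so the supremum of
    [g] over it exceeds every 2^l. *)
Lemma limf_esup_dyadic_infty (g : R -> \bar R) :
  (forall l m, exists2 k, (m <= k)%N & ((2 ^+ l)%:E <= g (dyadic k))%E) ->
  limf_esup g 0^'+ = +oo%E.
Proof.
move=> gl; apply/eqP; rewrite -leye_eq.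
apply: le_ereal_inf_tmp => _ [A [e /= e0 eA] <-].
rewrite leye_eq; apply/eqP/eqyP => r r0.
have [l rl] := exists_expr2_ge r.
have [m me] := exists_dyadic_lt e0.
have [k mk gk] := gl l m.
apply: (le_trans _ (le_trans gk _)); first by rewrite lee_fin.
apply: ereal_sup_ubound; exists (dyadic k) => //.
apply: eA; last exact: dyadic_gt0.
rewrite /= sub0r normrN gtr0_norm ?dyadic_gt0//.
by rewrite (le_lt_trans (dyadic_le mk)).
Qed.

End Dyadic.

(** * Survival for a short time *)

Section Cemetery.
Variables (R : realType) (M : pmetricType R).
Hypothesis M_locally_compact : locally_compact [set: M].
Variables (d : measure_display) (Om : measurableType d).
Variables (P : one_point_compactification M -> probability Om R).
Variables (X : R -> Om -> one_point_compactification M).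
Variable G : R -> set (set Om).
Hypothesis X_hunt : hunt_process P X G.

Lemma hunt_alive (x : M) : {ae P (Some x), forall w,
  exists2 e : R, 0 < e & forall t, 0 < t -> t < e -> X t w <> None}.
Proof.
(* Singletons are closed because the compactification of a locally compact Hausdorff space is
   Hausdorff. *)
have mX0 : measurable [set w | X 0 w = Some x].
  have mx : measurable ([set Some x] : set (borel (one_point_compactification M))).
    rewrite -[X in measurable X]setCK; apply: measurableC.
    apply: sub_sigma_algebra; apply: closed_openC.
    apply: accessible_closed_set1; apply: hausdorff_accessible.
    by apply: one_point_compactification_hausdorff; last exact: metric_hausdorff.
  exact: (measurable_preimage_hunt X_hunt (lexx 0) mx).
have : {ae P (Some x), forall w, X 0 w = Some x}.
  exists (~` [set w | X 0 w = Some x]); split => //; first exact: measurableC.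
  by rewrite probability_setC// (hu_normal X_hunt) subee.
apply: filterS => w X0.
have X_right : X s w @[s --> 0^'+] --> X 0 w by exact: (hu_right X_hunt).
have : nbhs (X 0 w) (Some @` [set: M]).
  by rewrite X0; apply: one_point_compactification_some_nbhs; exact: filterT.
move=> /X_right[e /= e0 eX]; exists e => // t t0 te.
have : (Some @` [set: M]) (X t w).
  by apply: eX => //=; rewrite sub0r normrN gtr0_norm.
by case=> z _ <-.
Qed.

End Cemetery.

(** * The limit superior at time 0 *)

Theorem theorem3p4 (R : realType) (M : pmetricType R)
  (M_locally_compact : locally_compact [set: M])
  (M_separable : separable M)
  (M_connected : connected [set: M])
  (M_balls : forall (x : M) (r : R), precompact (ball x r))
  (mu : {measure set (borel M) -> \bar R})
  (mu_radon : radon_on [set: M] mu)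
  (mu_support : full_support mu)
  (V : R -> R)
  (V_pos : forall r, 0 < r -> 0 < V r)
  (V_incr : forall r s, 0 < r -> r < s -> V r < V s)
  (V_0 : V r @[r --> 0^'+] --> (0 : R))
  (V_infty : V r @[r --> +oo] --> +oo)
  (Cs : R) (Cs_ge1 : 1 <= Cs)
  (mu_ball : forall (x : M) (r : R), 0 < r ->
     ((Cs^-1 * V r)%:E <= mu (ball x r) <= (Cs * V r)%:E)%E)
  (phi : R -> R)
  (phi_pos : forall r, 0 < r -> 0 < phi r)
  (phi_incr : forall r s, 0 < r -> r < s -> phi r < phi s)
  (F : set (M -> R)) (E : (M -> R) -> (M -> R) -> R)
  (n : {measure set (borel (M * M)%type) -> \bar R})
  (EF_dirichlet : dirichlet_form mu F E)
  (EF_regular : regular_form mu F E)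
  (n_jump : jump_measure n)
  (EF_jump : pure_jump F E n)
  (d : measure_display) (Om : measurableType d)
  (P : one_point_compactification M -> probability Om R)
  (X : R -> Om -> one_point_compactification M)
  (G : R -> set (set Om))
  (X_hunt : hunt_process P X G)
  (X_assoc : associated P X mu F E)
  (N : set M) (N_exc : properly_exceptional P X mu N)
  (p : R -> M -> M -> R) (p_hk : heat_kernel P X mu N p)
  (b C1 C2 : R) (b_gt0 : 0 < b) (C1_gt0 : 0 < C1) (C2_gt0 : 0 < C2)
  (p_bounds : forall x, ~ N x -> forall t, 0 < t -> t < b ->
     {ae mu, forall y : M, (ginv phi t <= (mdist x y)%:E)%E ->
        C1 * t / (V (mdist x y) * phi (mdist x y)) <= p t x y /\
        p t x y <= C2 * t / (V (mdist x y) * phi (mdist x y))})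
  (c1 c2 d1 d2 c : R) (c1_gt0 : 0 < c1) (c2_gt0 : 0 < c2)
  (d1_gt0 : 0 < d1) (d12 : d1 <= d2) (c_gt1 : 1 < c)
  (V_scaling : forall r s, 0 < r -> r < s ->
     c1 * (s / r) `^ d1 <= V s / V r /\ V s / V r <= c2 * (s / r) `^ d2)
  (phi_doubling : forall r, 0 < r -> phi (2 * r) <= c * phi r)
  (vphi : R -> R)
  (vphi_pos : forall t, 0 < t -> t < 1 -> 0 < vphi t)
  (vphi_incr : forall s t, 0 < s -> s <= t -> t < 1 -> vphi s <= vphi t)
  (vphi_int :
     (\int[lebesgue_measure]_(t in `]0%R, 1%R[) ((phi (vphi t))^-1)%:E = +oo)%E)
  (x : M) (Nx : ~ N x) :
  {ae P (Some x), forall w,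
    limf_esup (fun t : R =>
        ereal_sup [set (dist_from x (X s w))%:E | s in `]0%R, t]]
          * ((vphi t)^-1)%:E)%E 0^'+ =
      limf_esup (fun t : R => (dist_from x (X t w) / vphi t)%:E) 0^'+ /\
    limf_esup (fun t : R => (dist_from x (X t w) / vphi t)%:E) 0^'+ = +oo%E}.
Proof.
have c0 : 0 < c by rewrite (lt_trans _ c_gt1).
have [j annulus] := annulus_measure_ge V_pos Cs_ge1 mu_ball c1_gt0 d1_gt0
  (fun r s r0 rs => (V_scaling r s r0 rs).1).
have p_lower y : ~ N y -> forall t, 0 < t -> t < b ->
    {ae mu, forall z : M, (ginv phi t <= (mdist y z)%:E)%E ->
      C1 * t / (V (mdist y z) * phi (mdist y z)) <= p t y z}.
  move=> Ny t t0 tb.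
  apply: (@filterS (borel M) (almost_everywhere mu) _ _ _ _
    (p_bounds y Ny t t0 tb)) => z pz.
  by move=> /pz[].
have [k0 k0_gt0 hit] := ball_hitting_le V_pos V_incr phi_pos phi_incr c_gt1
  phi_doubling c2_gt0 (fun r s r0 rs => (V_scaling r s r0 rs).2) X_hunt p_hk
  C1_gt0 p_lower annulus ltr01.
pose f t := (phi (vphi t))^-1.
have phiv t : 0 < t -> t < 1 -> 0 < phi (vphi t).
  by move=> t0 t1; rewrite phi_pos// vphi_pos.
have a_infty := dyadic_series_infty (f := f) _ _ vphi_int.
have {}a_infty : (\sum_(k <oo) (f (dyadic R k.+1) * dyadic R k.+1)%:E = +oo)%E.
  apply: a_infty => [t t0 t1|s t s0 st t1].
    by rewrite invr_ge0 ltW// phiv.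
  have t0 := lt_le_trans s0 st; have s1 := le_lt_trans st t1.
  rewrite lef_pV2 ?posrE ?phiv//.
  by apply: (increasing_on_pos_le phi_incr); rewrite ?vphi_pos// vphi_incr.
have a_ge0 k : 0 <= f (dyadic R k.+1) * dyadic R k.+1.
  rewrite mulr_ge0 ?(ltW (dyadic_gt0 _ _))// invr_ge0 ltW// phiv//.
    exact: dyadic_gt0.
  exact: dyadic_lt1.
(* Beyond [m0] the time steps are short enough for the kernel bound (below [b]) and for [hit],
   instantiated with [R0 = 1] (below [phi 1]). *)
have [m0 m0_lt] : exists m0, dyadic R m0 < Num.min b (phi 1).
  by apply: exists_dyadic_lt; rewrite lt_min b_gt0 phi_pos.
have leave l m : {ae P (Some x), forall w, exists2 k, (m <= k)%N &
    ~ (Some @` ball x (2 ^+ l * vphi (dyadic R (m0 + k).+1)))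
      (X (dyadic R (m0 + k).+1) w)}.
  (* The radius factor is 2^l. The loss [c ^+ l] bounds phi(2^l vphi(t)) by phi(vphi(t)), and the 2
     comes from the time step being t/2. *)
  pose K := k0 / (2 * c ^+ l).
  have K0 : 0 < K by rewrite divr_gt0// mulr_gt0// exprn_gt0.
  pose q k := K * Num.min
    (f (dyadic R (m0 + k).+1) * dyadic R (m0 + k).+1) 1.
  apply: (ae_leave X_hunt (t_ := fun k => dyadic R (m0 + k).+1)
    (U := fun k => Some @` ball x (2 ^+ l * vphi (dyadic R (m0 + k).+1)))
    (q := q)).
  - by move=> k; exact: dyadic_gt0.
  - by move=> k; rewrite addnS; exact: dyadic_ltS.
  - by move=> k; exact: measurable_some_ball.
  (* Almost surely the path avoids [N], so [hit] may be started from its position. *)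
  - move=> k; have [_ _ /(_ x Nx)] := N_exc; apply: filterS => w [XN _].
    move=> [y yx Xy]; rewrite -Xy.
    have Ny : ~ N y.
      move=> Ny; apply: (XN (dyadic R (m0 + k.+1).+1)).
        exact: (ltW (dyadic_gt0 _ _)).
      by exists y.
    (* The gap between consecutive dyadic times equals the earlier time s = t/2. *)
    rewrite addnS dyadicB.
    set t := dyadic R (m0 + k).+1; set s := dyadic R (m0 + k).+2.
    have s0 : 0 < s := dyadic_gt0 _ _.
    have t0 : 0 < t := dyadic_gt0 _ _.
    have t1 : t < 1 := dyadic_lt1 _ _.
    have sm0 : s < Num.min b (phi 1).
      rewrite (le_lt_trans _ m0_lt)// dyadic_le//.
      by rewrite -addSn -addnS (leq_trans _ (leq_addr _ _)).
    move: sm0; rewrite lt_min => /andP[sb s1].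
    have st : s < t by exact: dyadic_ltS.
    have vt := vphi_pos t t0 t1.
    (* At time s the path is in the ball of radius 2^l vphi(s), which is no larger than the one for
       t. *)
    have xyr : mdist x y < 2 ^+ l * vphi t.
      move: yx; rewrite ballEmdist /= addnS => /lt_le_trans; apply.
      by rewrite ler_pM2l ?exprn_gt0// vphi_incr// ltW.
    apply: (le_trans (hit _ _ Ny _ _ s0 sb (ltW s1) xyr)).
    rewrite lee_fin lerD2l lerN2 /q -/t /K.
    have phit := phiv _ t0 t1.
    have cl : 0 < 2 * c ^+ l by rewrite mulr_gt0// exprn_gt0.
    have cl1 : 1 <= 2 * c ^+ l.
      by rewrite mulr_ege1 ?ler1n// exprn_ege1// ltW.
    rewrite -mulrA ler_pM2l// le_min; apply/andP; split.
      apply: (@le_trans _ _ ((2 * c ^+ l)^-1 * (f t * t))).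
        by rewrite ler_pM2l ?invr_gt0// ge_min lexx.
      rewrite ler_pdivlMr ?phi_pos ?mulr_gt0 ?exprn_gt0//.
      rewrite (le_trans (ler_wpM2l _ (doubling_expr c0 phi_doubling l vt)))//.
        by rewrite ltW// /f !mulr_gt0 ?invr_gt0.
      rewrite /s dyadicS -/t /f le_eqVlt; apply/orP; left; apply/eqP.
      by field; rewrite !gt_eqF// exprn_gt0.
    apply: (@le_trans _ _ ((2 * c ^+ l)^-1 * 1)).
      by rewrite ler_pM2l ?invr_gt0// ge_min lexx orbT.
    by rewrite mulr1 invf_le1.
  move=> B; have [i Bi] := truncated_series_unbounded a_ge0 a_infty (m0 + m) (B / K).
  exists i; rewrite -mulr_sumr mulrC -ler_pdivrMr//.
  by under eq_bigr do rewrite addnA.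
have {}leave : {ae P (Some x), forall w, forall l m, exists2 k, (m <= k)%N &
    ~ (Some @` ball x (2 ^+ l * vphi (dyadic R (m0 + k).+1)))
      (X (dyadic R (m0 + k).+1) w)}.
  (* Countably many pairs (l, m) allow a single null set. *)
  by apply: ae_foralln => l; apply: ae_foralln => m; exact: leave.
have alive := hunt_alive M_locally_compact X_hunt x.
apply: filterS2 leave alive => w leave [e e0 alive].
have far l m : exists k, [/\ (m <= k)%N, dyadic R k < 1 &
    2 ^+ l <= dist_from x (X (dyadic R k) w) / vphi (dyadic R k)].
  (* Times below [e] exclude the cemetery, where [dist_from] is 0; being outside the ball then does
     mean being far from x. *)
  have [m' m'e] := exists_dyadic_lt e0.
  have [k mk nball] := leave l (maxn m m').
  move: mk; rewrite geq_max => /andP[mk m'k].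
  exists (m0 + k).+1; split; last 1 first.
  - have t0 := dyadic_gt0 R (m0 + k).+1.
    have := alive _ t0; case Xt : (X _ w) nball => [z|] nball Xalive; last first.
      exfalso; apply: Xalive => //; rewrite (le_lt_trans _ m'e)// dyadic_le//.
      by rewrite (leq_trans m'k)// -addnS (leq_trans _ (leq_addl _ _)).
    rewrite /= ler_pdivlMr ?vphi_pos ?dyadic_lt1//.
    rewrite metric_sym leNgt; apply/negP => xz; apply: nball.
    by exists z => //; rewrite ballEmdist.
  - by rewrite (leq_trans mk)// -addnS (leq_trans _ (leq_addl _ _)).
  - exact: dyadic_lt1.
have limsup_infty : limf_esup (fun t : R =>
    (dist_from x (X t w) / vphi t)%:E) 0^'+ = +oo%E.
  apply: limf_esup_dyadic_infty => l m; have [k [mk _ farlk]] := far l m.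
  by exists k; rewrite ?lee_fin.
(* The two limits superior agree because both are infinite: the running supremum over ]0, t]
   includes the value at t. *)
split=> //; rewrite limsup_infty.
apply: limf_esup_dyadic_infty => l m; have [k [mk k1 farlk]] := far l m.
have t0 := dyadic_gt0 R k.
exists k => //; apply: (@le_trans _ _
  (dist_from x (X (dyadic R k) w) / vphi (dyadic R k))%:E).
  by rewrite lee_fin.
rewrite EFinM; apply: lee_wpmul2r.
  by rewrite lee_fin invr_ge0 ltW// vphi_pos.
apply: ereal_sup_ubound; exists (dyadic R k) => //.
by rewrite /= in_itv /= t0 lexx.
Qed.
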